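(* Let $W(z)=z^{a-2}e^{-b/z}$ be the scalar weight on $\gamma$ with $a\in\mathbb R\setminus\{-1,-2,\dots\}$ and $b\in\mathbb C$ with positive real part (and $W$ regular). Then, for all $n\in\mathbb N$, the monic orthogonal polynomials $P_n^{\mathsf L}$ and the functions of the second kind $Q_n^{\mathsf L}$ satisfy the second order equations $$z^2(P_n^{\mathsf L})''(z)+(az+b)(P_n^{\mathsf L})'(z)-n(a+n-1)P_n^{\mathsf L}(z)=0,$$ $$z^2(Q_n^{\mathsf L})''(z)+\big((4-a)z-b\big)(Q_n^{\mathsf L})'(z)-(n+1)(n+a-2)Q_n^{\mathsf L}(z)=0.$$
   Context: $\mathbb N=\{0,1,2,\dots\}$. $\gamma$ is a simple loop starting at the origin, encircling the point at infinity once in the positive direction, and then returning to the origin. Regular: the moments $W_n=\int_\gamma z^nW(z)\frac{dz}{2\pi i}$, $n\in\mathbb N$, exist and $\det[W_{j+k}]_{j,k=0,\dots,n}\neq0$ for all $n\in\mathbb N$. $P_n^{\mathsf L}$ is the monic polynomial of degree $n$ with $\int_\gamma P_n^{\mathsf L}(z)W(z)z^k\frac{dz}{2\pi i}=\delta_{n,k}C_n^{-1}$ for $k\in\{0,\dots,n\}$, $C_n\neq0$. The function of the second kind is $Q_n^{\mathsf L}(z)=\int_\gamma\frac{P_n^{\mathsf L}(z')}{z'-z}W(z')\frac{dz'}{2\pi i}$, $z\in\mathbb C\setminus\gamma$. *)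

(* Defs.v *)
(* The complex numbers are R[i] over a realType R, written R[i]^o where their
   topology or complex differentiation is used. *)
From HB Require Import structures.
From mathcomp Require Import all_boot all_order all_algebra.
From mathcomp Require Import complex.
From mathcomp Require Import all_classical all_reals all_analysis.
Import numFieldNormedType.Exports.
Import Order.TTheory GRing.Theory Num.Theory.

Set Implicit Arguments.
Unset Strict Implicit.
Unset Printing Implicit Defensive.

Local Open Scope classical_set_scope.
Local Open Scope complex_scope.
Local Open Scope ring_scope.

Section ComplexAnalysis.
Variable R : realType.
Implicit Types (g : R -> R[i]) (f : R[i] -> R[i]).

Definition cexp (z : R[i]) : R[i] :=
  (expR (complex.Re z))%:C * (cos (complex.Im z) +i* sin (complex.Im z)).

(* R[i] carries no normed module structure over R, so functions of a real
   variable are differentiated and integrated componentwise. *)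
Definition path_deriv g (t : R) : R[i] :=
  derive1 (fun s => complex.Re (g s)) t +i* derive1 (fun s => complex.Im (g s)) t.

Definition cintegrable (D : set R) g : Prop :=
  (@lebesgue_measure R).-integrable D (fun t => (complex.Re (g t))%:E) /\
  (@lebesgue_measure R).-integrable D (fun t => (complex.Im (g t))%:E).

Definition cintegral (D : set R) g : R[i] :=
  Rintegral (@lebesgue_measure R) D (fun t => complex.Re (g t)) +i*
  Rintegral (@lebesgue_measure R) D (fun t => complex.Im (g t)).

(* Paths are parametrised by [0, 1]. Integrating over the open interval keeps
   the end points, where the weight below is singular, out of the integral. *)
Definition contour_integrable g f : Prop :=
  cintegrable `]0, 1[ (fun t => f (g t) * path_deriv g t).

Definition contour_integral g f : R[i] :=
  cintegral `]0, 1[ (fun t => f (g t) * path_deriv g t).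

Definition two_pi_i : R[i] := 0 +i* (pi *+ 2).

(* Integral over g with respect to dz / (2 pi i). *)
Definition norm_contour_integral g f : R[i] :=
  contour_integral g f / two_pi_i.

Definition trace g : set R[i] := g @` `[0, 1].

(* s lists the interior points at which the derivative may jump. *)
Definition piecewise_C1 g : Prop :=
  {within `[0, 1], continuous (g : R -> R[i]^o)} /\
  exists s : seq R,
    [/\ forall t, t \in `]0, 1[ -> t \notin s ->
          [/\ derivable (fun u => complex.Re (g u)) t 1,
              derivable (fun u => complex.Im (g u)) t 1 &
              {for t, continuous (path_deriv g : R -> R[i]^o)}],
        forall t, t \in `[0, 1[ ->
          cvg ((path_deriv g : R -> R[i]^o) u @[u --> t^'+]) &
        forall t, t \in `]0, 1] ->
          cvg ((path_deriv g : R -> R[i]^o) u @[u --> t^'-])].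

Definition winding_number g (p : R[i]) : R[i] :=
  norm_contour_integral g (fun z => (z - p)^-1).

(* The Moebius map w = 1 / (z - z0) sends infinity to 0 and z0, which is off
   the loop, to infinity: in the coordinate w the loop has to wind once
   counterclockwise around w = 0. Seen in the z-plane it runs clockwise. *)
Definition encircles_infinity_once g : Prop :=
  exists2 z0 : R[i], ~ trace g z0 &
    winding_number (fun t => (g t - z0)^-1) 0 = 1.

Record loop_around_infinity g : Prop := LoopAroundInfinity {
  loop_piecewise_C1 : piecewise_C1 g;
  loop_start : g 0 = 0;
  loop_end : g 1 = 0;
  loop_simple : forall s t : R,
    s \in `[0, 1[ -> t \in `[0, 1[ -> g s = g t -> s = t;
  loop_encircles : encircles_infinity_once g }.

(* lg is a determination of the logarithm on the loop minus its base point 0,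
   continuous along the loop. *)
Definition log_branch_along g (lg : R[i] -> R[i]) : Prop :=
  forall t : R, t \in `]0, 1[ ->
    cexp (lg (g t)) = g t /\
    {for t, continuous ((fun u => lg (g u)) : R -> R[i]^o)}.

(* z ^ (a - 2) * exp (- b / z), the power being defined through lg. *)
Definition bessel_weight (lg : R[i] -> R[i]) (a : R) (b z : R[i]) : R[i] :=
  cexp ((a - 2)%:C * lg z) * cexp (- b / z).

Definition moment g (W : R[i] -> R[i]) (n : nat) : R[i] :=
  norm_contour_integral g (fun z => z ^+ n * W z).

Definition regular_weight g (W : R[i] -> R[i]) : Prop :=
  (forall n : nat, contour_integrable g (fun z => z ^+ n * W z)) /\
  (forall n : nat,
     \det (\matrix_(j < n.+1, k < n.+1) moment g W (j + k)) != 0).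

Definition monic_orthogonal g (W : R[i] -> R[i]) (n : nat)
    (P : {poly R[i]}) : Prop :=
  [/\ P \is monic, size P = n.+1 &
      exists2 c : R[i], c != 0 & forall k : nat, (k <= n)%N ->
        norm_contour_integral g (fun z => P.[z] * W z * z ^+ k)
        = (n == k)%:R * c^-1].

Definition second_kind g (W : R[i] -> R[i]) (P : {poly R[i]}) (z : R[i]) : R[i] :=
  norm_contour_integral g (fun z' => P.[z'] / (z' - z) * W z').

End ComplexAnalysis.

(* Main.v *)
(* The Pearson equation [(z^2 W)' = (a z + b) W] integrates along the loop to
   [\int (z^2 q' + (a z + b) q) W dz = 0] for [q] smooth along the loop: the
   boundary terms vanish because [z^2 W] has limits at both ends (its derivative
   is integrable), and a nonzero limit would make [dz / z^2] integrable there,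
   that is [1 / z] bounded as [z] tends to 0. Hence
   [T p = z^2 p'' + (a z + b) p'] is symmetric for the pairing
   [(p, q) |-> \int p q W dz]. As [T] does not raise degrees,
   [T P_n - n (a + n - 1) P_n] has degree less than [n] and is orthogonal to all
   polynomials of degree less than [n], so it is 0 by regularity. Taking
   [q = P_n' h - P_n h'] with [h = 1 / (zeta - z)], and noting that the [z]
   derivatives of [h] are [h^2] and [2 h^3], turns the eigenvalue equation for
   [P_n] into the one for [Q_n]. *)
Require Import Defs.
From HB Require Import structures.
From mathcomp Require Import all_boot all_order all_algebra.
From mathcomp Require Import complex.
From mathcomp Require Import all_classical all_reals all_analysis.
From mathcomp Require Import measurable_realfun ring lra.
Import numFieldNormedType.Exports.
Import Order.TTheory GRing.Theory Num.Theory.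
Local Open Scope classical_set_scope.
Local Open Scope complex_scope.
Local Open Scope ring_scope.
Set Implicit Arguments.
Unset Strict Implicit.
Unset Printing Implicit Defensive.

(** * Calculus along paths *)

Section RealFTC.
Variable R : realType.
Notation mu := (@lebesgue_measure R).

(* [is_derive] is a type class, and resolving it under binders diverges. *)
Definition has_derive (F : R -> R) (t l : R) : Prop := is_derive t 1 F l.

(** Induction on the exceptional list: a point of [s] inside the interval splits it into two pieces
    sharing that end point, and continuity there glues the two constants. With no exception left
    this is the mean value theorem. *)
Lemma derive0_off_finite_const (H : R -> R) (s : seq R) (x y : R) :
  x <= y -> {within `[x, y], continuous H} ->
  (forall t, t \in `]x, y[ -> t \notin s -> has_derive H t 0) ->
  H x = H y.
Proof.
elim: s x y => [|e s IHs] x y xy cH dH.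
  have [c _ ] := MVT_segment xy (fun t tI => dH t tI isT) cH.
  by rewrite mul0r => /eqP; rewrite subr_eq0 => /eqP ->.
have [eI|eNI] := boolP (e \in `]x, y[); last first.
  apply: IHs => // t tI ts; apply: dH => //.
  by rewrite inE negb_or ts andbT; apply: contraNneq eNI => <-.
have /andP[xe ey] : x < e < y by move: eI; rewrite in_itv.
suff [-> ->] : H x = H e /\ H e = H y by [].
split; [have := IHs x e (ltW xe)|have := IHs e y (ltW ey)]; apply.
- by apply: continuous_subspaceW cH; apply: subset_itvl; rewrite bnd_simp ltW.
- move=> t; rewrite in_itv/= => /andP[xt te] ts; apply: dH.
    by rewrite in_itv/= xt (lt_trans te).
  by rewrite inE negb_or ts lt_eqF.
- by apply: continuous_subspaceW cH; apply: subset_itvr; rewrite bnd_simp ltW.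
- move=> t; rewrite in_itv/= => /andP[et ty] ts; apply: dH.
    by rewrite in_itv/= ty (lt_trans xe).
  by rewrite inE negb_or ts gt_eqF.
Qed.

(** The one-sided limits of [F] are part of the conclusion, since nothing is assumed at the ends,
    where the weight is singular. They exist because [F] differs by a constant from the integral of
    [f] with variable upper bound, which is continuous up to the ends. *)
Lemma FTC_off_finite (f F : R -> R) (s : seq R) (c d : R) : c < d ->
  mu.-integrable `]c, d[ (EFin \o f) ->
  (forall t, t \in `]c, d[ -> {for t, continuous F}) ->
  (forall t, t \in `]c, d[ -> t \notin s -> has_derive F t (f t)) ->
  (forall t, t \in `]c, d[ -> t \notin s -> {for t, continuous f}) ->
  exists l : R, F x @[x --> c^'+] --> l /\
    F x @[x --> d^'-] --> l + \int[mu]_(t in `]c, d[) f t.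
Proof.
move=> cd intf cF dF cf.
(* Extension by 0 gives an integrable function on the closed interval without changing the
   integral. *)
pose f0 := f \_ `]c, d[.
have f0E t : t \in `]c, d[ -> f0 t = f t.
  by move=> tI; rewrite /f0 patchE mem_set.
have if0 : mu.-integrable `[c, d] (EFin \o f0).
  rewrite -restrict_EFin; apply/integrable_restrict => //=.
  by rewrite setIidr//; exact: subset_itv_oo_cc.
pose G x := parameterized_integral mu c x f0.
have cG : {within `[c, d], continuous G}.
  exact: parameterized_integral_continuous (ltW cd) if0.
have [cG1 cG2 cG3] := (continuous_within_itvP _ cd).1 cG.
have Gc : G c = 0.
  by rewrite /G /parameterized_integral set_itv1 Rintegral_set1.
have Gd : G d = \int[mu]_(t in `]c, d[) f t.
  rewrite /G /parameterized_integral.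
  rewrite -Rintegral_itv_bndo_bndc; last first.
    by apply: integrableS if0 => //; apply: subset_itvl; rewrite bnd_simp.
  rewrite -Rintegral_itv_obnd_cbnd; last first.
    by apply: integrableS if0 => //; exact: subset_itv_oo_cc.
  by apply: eq_Rintegral => x; rewrite inE/= => xI; rewrite f0E.
have dG t : t \in `]c, d[ -> t \notin s -> has_derive G t (f t).
  move=> tI ts; have /andP[ct td] : c < t < d by move: tI; rewrite in_itv.
  have cf0 : {for t, continuous f0}.
    rewrite /prop_for /continuous_at f0E//.
    apply: cvg_trans (cf _ tI ts); apply: near_eq_cvg.
    near=> x; rewrite f0E//; near: x.
    exact: near_in_itvoo.
  have [dG1 dG2] := continuous_FTC1_closed td if0 ct cf0.
  apply: DeriveDef => //; rewrite -derive1E.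
  by rewrite -f0E// -dG2.
pose H x := F x - G x.
have cH t : t \in `]c, d[ -> {for t, continuous H}.
  by move=> tI; apply: cvgB; [exact: cF|exact: cG1].
have HE x y : x \in `]c, d[ -> y \in `]c, d[ -> x <= y -> H x = H y.
  move=> xI yI xy; apply: (@derive0_off_finite_const _ s) => //.
    apply: continuous_in_subspaceT => t; rewrite inE/= in_itv/= => /andP[xt ty].
    apply: cH; move: xI yI; rewrite !in_itv/= => /andP[cx _] /andP[_ yd].
    by rewrite (lt_le_trans cx)// (le_lt_trans ty).
  move=> t; rewrite in_itv/= => /andP[xt ty] ts.
  have tI : t \in `]c, d[.
    move: xI yI; rewrite !in_itv/= => /andP[cx _] /andP[_ yd].
    by rewrite (lt_trans cx)// (lt_trans ty).
  rewrite -(subrr (f t)).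
  by apply: is_deriveB; [exact: dF|exact: dG].
(* Any interior point would do to name the constant value of [H]. *)
pose m := (c + d) / 2.
have mI : m \in `]c, d[ by rewrite in_itv/= midf_lt//= midf_lt.
have FE x : x \in `]c, d[ -> F x = H m + G x.
  move=> xI; suff <- : H x = H m by rewrite /H subrK.
  have [xm|/ltW mx] := leP x m; first exact: HE.
  by apply/esym; exact: HE.
exists (H m); split.
- rewrite -[X in _ --> X]addr0 -Gc.
  apply: cvg_trans (cvgD (cvg_cst (H m)) cG2); apply: near_eq_cvg.
  near=> x; rewrite FE//.
  rewrite in_itv/=; apply/andP; split; near: x.
    exact: nbhs_right_gt.
  exact: nbhs_right_lt.
- rewrite -Gd.
  apply: cvg_trans (cvgD (cvg_cst (H m)) cG3); apply: near_eq_cvg.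
  near=> x; rewrite FE//.
  rewrite in_itv/=; apply/andP; split; near: x.
    exact: nbhs_left_gt.
  exact: nbhs_left_lt.
Unshelve. all: by end_near. Qed.
End RealFTC.

(** * Continuity and derivatives of complex-valued functions of a real variable *)

Section ComplexPaths.
Variable R : realType.
Implicit Types (g h : R -> R[i]) (z w : R[i]) (t : R).

Lemma ReD z w : complex.Re (z + w) = complex.Re z + complex.Re w.
Proof. by case: z; case: w. Qed.

Lemma ImD z w : complex.Im (z + w) = complex.Im z + complex.Im w.
Proof. by case: z; case: w. Qed.

Lemma ReN z : complex.Re (- z) = - complex.Re z.
Proof. by case: z. Qed.

Lemma ImN z : complex.Im (- z) = - complex.Im z.
Proof. by case: z. Qed.

Lemma ReM z w : complex.Re (z * w) =
  complex.Re z * complex.Re w - complex.Im z * complex.Im w.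
Proof. by case: z; case: w. Qed.

Lemma ImM z w : complex.Im (z * w) =
  complex.Re z * complex.Im w + complex.Im z * complex.Re w.
Proof. by case: z => a b; case: w => c d /=. Qed.

Lemma ReV z : complex.Re z^-1 =
  complex.Re z / (complex.Re z ^+ 2 + complex.Im z ^+ 2).
Proof. by case: z. Qed.

Lemma ImV z : complex.Im z^-1 =
  - (complex.Im z / (complex.Re z ^+ 2 + complex.Im z ^+ 2)).
Proof. by case: z => a b /=. Qed.

Lemma complexP z w :
  complex.Re z = complex.Re w -> complex.Im z = complex.Im w -> z = w.
Proof. by case: z => a b; case: w => c d /= -> ->. Qed.

Lemma sqr_modulus_neq0 z : z != 0 -> complex.Re z ^+ 2 + complex.Im z ^+ 2 != 0.
Proof.
apply: contra_neq => /eqP; rewrite paddr_eq0 ?sqr_ge0// !sqrf_eq0.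
by case: z => a b /= /andP[/eqP -> /eqP ->].
Qed.

Lemma normr_Re_le (r : R) z : `|z| <= r%:C -> `|complex.Re z| <= r.
Proof.
rewrite normc_def lecR; apply: le_trans.
by rewrite -sqrtr_sqr ler_wsqrtr// lerDl sqr_ge0.
Qed.

Lemma normr_Im_le (r : R) z : `|z| <= r%:C -> `|complex.Im z| <= r.
Proof.
rewrite normc_def lecR; apply: le_trans.
by rewrite -sqrtr_sqr ler_wsqrtr// lerDr sqr_ge0.
Qed.

Definition ccont g t : Prop :=
  {for t, continuous (fun s => complex.Re (g s))} /\
  {for t, continuous (fun s => complex.Im (g s))}.

Definition cderiv g t z : Prop :=
  has_derive (fun s => complex.Re (g s)) t (complex.Re z) /\
  has_derive (fun s => complex.Im (g s)) t (complex.Im z).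

Lemma cvg_complex (T : Type) (F : set_system T) (FF : Filter F)
    (g : T -> R[i]^o) (l : R[i]^o) :
  g x @[x --> F] --> l ->
  complex.Re (g x) @[x --> F] --> complex.Re l /\
  complex.Im (g x) @[x --> F] --> complex.Im l.
Proof.
move=> /cvgrPdist_le gl; split; apply/cvgrPdist_le => e e0.
all: have e0' : 0 < e%:C by rewrite ltcR.
all: apply: filterS (gl _ e0') => x.
- by move=> /normr_Re_le; rewrite ReD ReN.
- by move=> /normr_Im_le; rewrite ImD ImN.
Qed.

Lemma ccontP g t : {for t, continuous (g : R -> R[i]^o)} -> ccont g t.
Proof. by move=> /cvg_complex. Qed.

Lemma ccont_cst z t : ccont (fun=> z) t.
Proof. by split; exact: cvg_cst. Qed.

Lemma ccontD g h t : ccont g t -> ccont h t -> ccont (fun s => g s + h s) t.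
Proof.
move=> [g1 g2] [h1 h2]; split.
- under [X in {for _, continuous X}]funext do rewrite ReD; exact: cvgD.
- under [X in {for _, continuous X}]funext do rewrite ImD; exact: cvgD.
Qed.

Lemma ccontN g t : ccont g t -> ccont (fun s => - g s) t.
Proof.
move=> [g1 g2]; split.
- under [X in {for _, continuous X}]funext do rewrite ReN; exact: cvgN.
- under [X in {for _, continuous X}]funext do rewrite ImN; exact: cvgN.
Qed.

Lemma ccontM g h t : ccont g t -> ccont h t -> ccont (fun s => g s * h s) t.
Proof.
move=> [g1 g2] [h1 h2]; split.
- under [X in {for _, continuous X}]funext do rewrite ReM.
  by apply: cvgB; exact: cvgM.
- under [X in {for _, continuous X}]funext do rewrite ImM.
  by apply: cvgD; exact: cvgM.
Qed.

Lemma ccontV g t : g t != 0 -> ccont g t -> ccont (fun s => (g s)^-1) t.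
Proof.
move=> gt0 [g1 g2].
have c2 : {for t, continuous
    (fun s => (complex.Re (g s) ^+ 2 + complex.Im (g s) ^+ 2)^-1)}.
  apply: cvgV; first exact: sqr_modulus_neq0.
  apply: cvgD; rewrite expr2; under [X in X @ _]funext do rewrite expr2.
    exact: cvgM.
  exact: cvgM.
split.
- under [X in {for _, continuous X}]funext do rewrite ReV; exact: cvgM.
- under [X in {for _, continuous X}]funext do rewrite ImV.
  by apply: cvgN; exact: cvgM.
Qed.

Lemma ccont_cexp g t : ccont g t -> ccont (fun s => cexp (g s)) t.
Proof.
move=> [g1 g2]; apply: ccontM; split => /=.
- by apply: (@continuous_comp _ _ _ _ expR) => //; exact: continuous_expR.
- exact: cvg_cst.
- by apply: (@continuous_comp _ _ _ _ cos) => //; exact: continuous_cos.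
- by apply: (@continuous_comp _ _ _ _ sin) => //; exact: continuous_sin.
Qed.

Lemma cderiv_cst z t : cderiv (fun=> z) t 0.
Proof. by split; exact: is_derive_cst. Qed.

Lemma cderivD g h t z w : cderiv g t z -> cderiv h t w ->
  cderiv (fun s => g s + h s) t (z + w).
Proof.
move=> [g1 g2] [h1 h2]; split.
- rewrite ReD; under [X in has_derive X]funext do rewrite ReD.
  exact: is_deriveD.
- rewrite ImD; under [X in has_derive X]funext do rewrite ImD.
  exact: is_deriveD.
Qed.

Lemma has_deriveM (F G : R -> R) t k l : has_derive F t k -> has_derive G t l ->
  has_derive (fun s => F s * G s) t (F t * l + G t * k).
Proof. exact: is_deriveM. Qed.

Lemma cderivM g h t z w : cderiv g t z -> cderiv h t w ->
  cderiv (fun s => g s * h s) t (z * h t + g t * w).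
Proof.
move=> [g1 g2] [h1 h2]; split.
- under [X in has_derive X]funext do rewrite ReM.
  have := is_deriveB (has_deriveM g1 h1) (has_deriveM g2 h2).
  by congr is_derive; rewrite ReD !ReM; ring.
- under [X in has_derive X]funext do rewrite ImM.
  have := is_deriveD (has_deriveM g1 h2) (has_deriveM g2 h1).
  by congr is_derive; rewrite ImD !ImM; ring.
Qed.

Lemma has_deriveD (F G : R -> R) t k l : has_derive F t k -> has_derive G t l ->
  has_derive (fun s => F s + G s) t (k + l).
Proof. exact: is_deriveD. Qed.

Lemma has_deriveV (F : R -> R) t k : F t != 0 -> has_derive F t k ->
  has_derive (fun s => (F s)^-1) t (- (F t) ^- 2 * k).
Proof. exact: is_deriveV. Qed.

Lemma cderivV g t z : g t != 0 -> cderiv g t z ->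
  cderiv (fun s => (g s)^-1) t (- (z / g t ^+ 2)).
Proof.
move=> gt0 [g1 g2].
have m0 := sqr_modulus_neq0 gt0.
have m0' : complex.Re (g t) * complex.Re (g t)
    + complex.Im (g t) * complex.Im (g t) != 0 by rewrite -!expr2.
have dS := has_deriveD (has_deriveM g1 g1) (has_deriveM g2 g2).
have dN := has_deriveV (F := fun s => _ + _) m0' dS.
have zE : z = complex.Re z +i* complex.Im z by case: (z).
have gE : g t = complex.Re (g t) +i* complex.Im (g t) by case: (g t).
have g2E : (g t ^+ 2)^-1 = ((g t)^-1) ^+ 2 by rewrite exprVn.
split.
- under [X in has_derive X]funext do rewrite ReV !expr2.
  have := has_deriveM g1 dN.
  congr is_derive; rewrite g2E expr2 ReN !(ReM, ImM, ReV, ImV) /=.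
  by field; exact: m0.
- under [X in has_derive X]funext do rewrite ImV !expr2.
  have := is_deriveN (has_deriveM g2 dN).
  congr is_derive; rewrite g2E expr2 ImN !(ReM, ImM, ReV, ImV) /=.
  by field; exact: m0.
Qed.

Lemma has_derive_comp (F G : R -> R) t k l :
  has_derive F (G t) k -> has_derive G t l ->
  has_derive (fun s => F (G s)) t (k * l).
Proof. exact: is_derive1_comp. Qed.

Lemma cderiv_cexp g t z : cderiv g t z ->
  cderiv (fun s => cexp (g s)) t (z * cexp (g t)).
Proof.
move=> [g1 g2].
have dE := has_derive_comp (is_derive_expR (complex.Re (g t))) g1.
have dc := has_derive_comp (is_derive_cos (complex.Im (g t))) g2.
have ds := has_derive_comp (is_derive_sin (complex.Im (g t))) g2.
split.
- under [X in has_derive X]funext do rewrite ReM /= mul0r subr0.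
  have := has_deriveM dE dc.
  by congr is_derive; rewrite /cexp !(ReM, ImM) /=; ring.
- under [X in has_derive X]funext do rewrite ImM /= mul0r addr0.
  have := has_deriveM dE ds.
  by congr is_derive; rewrite /cexp !(ReM, ImM) /=; ring.
Qed.

Lemma path_derivP g t :
  derivable (fun u => complex.Re (g u)) t 1 ->
  derivable (fun u => complex.Im (g u)) t 1 -> cderiv g t (path_deriv g t).
Proof. by move=> d1 d2; split; apply: DeriveDef => //=; rewrite derive1E. Qed.

Lemma cexp0 : cexp 0 = 1 :> R[i].
Proof. by apply: complexP; rewrite /cexp !(ReM, ImM) /= expR0 cos0 sin0; ring. Qed.

Lemma cexpD z w : cexp (z + w) = cexp z * cexp w.
Proof.
by apply: complexP; rewrite /cexp !(ReM, ImM) /= ReD ImD expRD cosD sinD; ring.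
Qed.

Lemma cexp_neq0 z : cexp z != 0.
Proof.
apply/eqP => z0; have := cexpD z (- z).
by rewrite subrr cexp0 z0 mul0r => /eqP; rewrite oner_eq0.
Qed.

End ComplexPaths.

(** * Logarithms along a path, and integrals with bounded multipliers *)

Section ComplexIntegrals.
Variable R : realType.
Implicit Types (g h q f : R -> R[i]) (z w : R[i]) (t : R) (D : set R).
Notation mu := (@lebesgue_measure R).

(** A continuous logarithm of a differentiable path is differentiable. With [v s = g s / g t], the
    increment [u s - u t] is a logarithm of [v s] whose imaginary part is small near [t], so its two
    components are given by the explicit formulas [ln (|v| ^ 2) / 2] and [atan (Im v / Re v)]. *)
Lemma cderiv_log (u g : R -> R[i]) t z :
  (\forall s \near t, cexp (u s) = g s) -> ccont u t -> cderiv g t z ->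
  cderiv u t (z / g t).
Proof.
move=> ug [cu1 cu2] dg.
have ut := nbhs_singleton ug.
have gt0 : g t != 0 by rewrite -ut cexp_neq0.
pose v s := g s * (g t)^-1.
have [dv1 dv2] : cderiv v t (z / g t).
  have := cderivM dg (cderiv_cst (g t)^-1 t).
  by rewrite mulr0 addr0.
have vt : v t = 1 by rewrite /v divff.
have vE : \forall s \near t, v s = cexp (u s - u t).
  apply: filterS ug => s us.
  rewrite cexpD us /v -[in LHS]ut; congr (_ * _).
  apply: (mulfI (cexp_neq0 (u t))).
  by rewrite divff ?cexp_neq0// -cexpD subrr cexp0.
have pi2_gt0 : 0 < pi / 2 :> R by rewrite divr_gt0// pi_gt0.
(* Continuity of [u] selects the branch on which [atan] inverts [tan]. *)
have dE : \forall s \near t,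
    - (pi / 2) < complex.Im (u s - u t) < pi / 2.
  have /cvgrPdist_lt/(_ _ pi2_gt0) := cu2.
  by apply: filterS => s; rewrite distrC ltr_norml ImD ImN.
split.
(* Real part: half the logarithm of the squared modulus, which equals 1 at [t]. *)
- have dS := has_deriveD (has_deriveM dv1 dv1) (has_deriveM dv2 dv2).
  have S1 : complex.Re (v t) * complex.Re (v t) +
      complex.Im (v t) * complex.Im (v t) = 1.
    by rewrite vt /=; ring.
  have dl : has_derive (@ln R) (complex.Re (v t) * complex.Re (v t) +
      complex.Im (v t) * complex.Im (v t)) 1.
    by rewrite S1 -[X in has_derive _ _ X]invr1; exact: is_derive1_ln.
  have dlS := has_derive_comp (G := fun s => _ + _) dl dS.
  have dr := has_deriveD (is_derive_cst (complex.Re (u t)) t 1)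
    (has_deriveM (is_derive_cst (2^-1 : R) t 1) dlS).
  have dr' : has_derive
    (fun s => complex.Re (u t) + 2^-1 * ln (complex.Re (v s) * complex.Re (v s) +
      complex.Im (v s) * complex.Im (v s))) t (complex.Re (z / g t)).
    by move: dr; congr is_derive; rewrite vt /= /cst; field.
  apply: near_eq_is_derive dr'; near=> s.
  have -> : v s = cexp (u s - u t) by near: s; exact: vE.
  rewrite /cexp !(ReM, ImM) /=.
  set r := complex.Re (u s - u t); set d := complex.Im (u s - u t).
  have -> : (expR r * cos d - 0 * sin d) * (expR r * cos d - 0 * sin d) +
    (expR r * sin d + 0 * cos d) * (expR r * sin d + 0 * cos d) =
    expR r * expR r * (cos d ^+ 2 + sin d ^+ 2) by ring.
  by rewrite cos2Dsin2 mulr1 -expRD expRK /r ReD ReN; field.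
(* Imaginary part: the arctangent of the slope of [v], which is 0 at [t]. *)
- have v10 : complex.Re (v t) != 0 by rewrite vt oner_eq0.
  have dT := has_deriveM dv2 (has_deriveV v10 dv1).
  have dA := has_derive_comp (G := fun s => _ * _) (is_derive1_atan _) dT.
  have dr := has_deriveD (is_derive_cst (complex.Im (u t)) t 1) dA.
  have dr' : has_derive
    (fun s => complex.Im (u t) + atan (complex.Im (v s) / complex.Re (v s))) t
    (complex.Im (z / g t)).
    by move: dr; congr is_derive; rewrite vt /=; field.
  apply: near_eq_is_derive dr'; near=> s.
  have sI : - (pi / 2) < complex.Im (u s - u t) < pi / 2 by near: s.
  have -> : v s = cexp (u s - u t) by near: s; exact: vE.
  rewrite /cexp !(ReM, ImM) /=.
  set r := complex.Re (u s - u t); set d := complex.Im (u s - u t).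
  have -> : (expR r * sin d + 0 * cos d) / (expR r * cos d - 0 * sin d) = tan d.
    by rewrite !mul0r addr0 subr0 -mulf_div divff ?mul1r// gt_eqF// expR_gt0.
  rewrite tanK; last by rewrite in_itv.
  by rewrite /d ImD ImN addrC subrK.
Unshelve. all: by end_near. Qed.


Definition ccvg (F : set_system R) g z : Prop :=
  complex.Re (g x) @[x --> F] --> complex.Re z /\
  complex.Im (g x) @[x --> F] --> complex.Im z.

Lemma complex_FTC f (F : R -> R[i]) (s : seq R) (c d : R) : c < d ->
  cintegrable `]c, d[ f ->
  (forall t, t \in `]c, d[ -> ccont F t) ->
  (forall t, t \in `]c, d[ -> t \notin s -> cderiv F t (f t)) ->
  (forall t, t \in `]c, d[ -> t \notin s -> ccont f t) ->
  exists l : R[i], ccvg c^'+ F l /\ ccvg d^'- F (l + cintegral `]c, d[ f).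
Proof.
move=> cd [f1 f2] cF dF cf.
have [l1 [l1c l1d]] := FTC_off_finite cd f1 (fun t tI => (cF t tI).1)
  (fun t tI ts => (dF t tI ts).1) (fun t tI ts => (cf t tI ts).1).
have [l2 [l2c l2d]] := FTC_off_finite cd f2 (fun t tI => (cF t tI).2)
  (fun t tI ts => (dF t tI ts).2) (fun t tI ts => (cf t tI ts).2).
by exists (l1 +i* l2).
Qed.

(* At type [set R] the canonical measurable structure found for [R] is not the
   one carried by [lebesgue_measure], hence the ascription on [D]. *)
Lemma cintegralD D f g : measurable (D : set (measurableTypeR R)) ->
  cintegrable D f -> cintegrable D g ->
  cintegral D (fun t => f t + g t) = cintegral D f + cintegral D g.
Proof.
move=> mD [f1 f2] [g1 g2]; apply: complexP => /=.
- by rewrite -RintegralD//; apply: eq_Rintegral => t _; rewrite ReD.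
- by rewrite -RintegralD//; apply: eq_Rintegral => t _; rewrite ImD.
Qed.

Lemma eq_cintegral D f g : (forall t, D t -> f t = g t) ->
  cintegral D f = cintegral D g.
Proof.
move=> fg; congr Complex; apply: eq_Rintegral => t; rewrite inE => Dt.
all: by rewrite fg.
Qed.

Lemma eq_cintegrable D f g : measurable (D : set (measurableTypeR R)) ->
  (forall t, D t -> f t = g t) ->
  cintegrable D f -> cintegrable D g.
Proof.
move=> mD fg [f1 f2]; split; [move: f1|move: f2]; apply: eq_integrable => // t.
all: by rewrite inE => Dt; rewrite fg.
Qed.

(** The class of multipliers used throughout: it is stable under sums and products, and multiplying
    by a member preserves [cintegrable] on an open measurable set, continuity providing
    measurability. *)
Definition bounded_cont D q : Prop :=
  (forall t, D t -> ccont q t) /\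
  exists M : R, forall t, D t -> `|q t| <= M%:C.

Lemma bounded_cont_cst D z : bounded_cont D (fun=> z).
Proof.
split=> [t _|]; first exact: ccont_cst.
exists (Num.sqrt (complex.Re z ^+ 2 + complex.Im z ^+ 2)) => t _.
by rewrite normc_def.
Qed.

Lemma bounded_contD D q h : bounded_cont D q -> bounded_cont D h ->
  bounded_cont D (fun t => q t + h t).
Proof.
move=> [cq [M qM]] [ch [N hN]]; split=> [t Dt|].
  by apply: ccontD; [exact: cq|exact: ch].
exists (M + N) => t Dt; rewrite rmorphD.
by rewrite (le_trans (ler_normD _ _))// lerD ?qM ?hN.
Qed.

Lemma bounded_contM D q h : bounded_cont D q -> bounded_cont D h ->
  bounded_cont D (fun t => q t * h t).
Proof.
move=> [cq [M qM]] [ch [N hN]]; split=> [t Dt|].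
  by apply: ccontM; [exact: cq|exact: ch].
by exists (M * N) => t Dt; rewrite rmorphM normrM ler_pM ?qM ?hN.
Qed.

Lemma bounded_contN D q : bounded_cont D q -> bounded_cont D (fun t => - q t).
Proof.
move=> [cq [M qM]]; split=> [t Dt|]; first by apply: ccontN; exact: cq.
by exists M => t Dt; rewrite normrN qM.
Qed.

Lemma bounded_contV D q (d : R) : 0 < d ->
  (forall t, D t -> ccont q t) -> (forall t, D t -> d%:C <= `|q t|) ->
  bounded_cont D (fun t => (q t)^-1).
Proof.
move=> d0 cq dq; have d0' : 0 < d%:C by rewrite ltcR.
split=> [t Dt|].
  apply: ccontV; last exact: cq.
  by rewrite -normr_gt0 (lt_le_trans d0')// dq.
exists d^-1 => t Dt; rewrite fmorphV normfV lef_pV2 ?dq// posrE//.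
by rewrite (lt_le_trans d0')// dq.
Qed.

Lemma bounded_cont_integrable D q f : open D ->
  measurable (D : set (measurableTypeR R)) -> bounded_cont D q ->
  cintegrable D f -> cintegrable D (fun t => q t * f t).
Proof.
move=> oD mD [cq [M qM]] [f1 f2].
have m1 : measurable_fun D (fun t => complex.Re (q t)).
  by apply: open_continuous_measurable_fun => // t; rewrite inE => /cq[].
have m2 : measurable_fun D (fun t => complex.Im (q t)).
  by apply: open_continuous_measurable_fun => // t; rewrite inE => /cq[].
have b1 : [bounded complex.Re (q t) | t in D].
  exists M; split; first exact: num_real.
  by move=> x Mx t Dt; apply: (le_trans (normr_Re_le (qM t Dt))); exact: ltW.
have b2 : [bounded complex.Im (q t) | t in D].
  exists M; split; first exact: num_real.
  by move=> x Mx t Dt; apply: (le_trans (normr_Im_le (qM t Dt))); exact: ltW.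
split.
- under eq_fun do rewrite ReM EFinB !EFinM.
  by apply: (integrableB mD); exact: (integrableMr mD).
- under eq_fun do rewrite ImM EFinD !EFinM.
  by apply: (integrableD mD); exact: (integrableMr mD).
Qed.

Lemma integrable_mull (D : set (measurableTypeR R)) (k : R) (F : R -> R) :
  measurable D -> mu.-integrable D (EFin \o F) ->
  mu.-integrable D (EFin \o (fun t => k * F t)).
Proof.
move=> mD iF; have := integrableZl mD k iF.
by apply: eq_integrable.
Qed.

Lemma cintegralZ D z f : measurable (D : set (measurableTypeR R)) ->
  cintegrable D f ->
  cintegral D (fun t => z * f t) = z * cintegral D f.
Proof.
move=> mD [f1 f2]; apply: complexP; rewrite ?(ReM, ImM) /=.
- rewrite -!RintegralZl// -RintegralB//; last 2 first.
  + exact: integrable_mull.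
  + exact: integrable_mull.
  by apply: eq_Rintegral => t _; rewrite ReM.
- rewrite -!RintegralZl// -RintegralD//; last 2 first.
  + exact: integrable_mull.
  + exact: integrable_mull.
  by apply: eq_Rintegral => t _; rewrite ImM.
Qed.

Lemma normr_complex_le z :
  `|z| <= (`|complex.Re z| + `|complex.Im z|)%:C.
Proof.
rewrite normc_def lecR -[leRHS]ger0_norm ?addr_ge0//.
rewrite -sqrtr_sqr ler_wsqrtr// sqrrD !real_normK ?num_real//.
by rewrite lerD2r lerDl mulrn_wge0 ?mulr_ge0.
Qed.

(** The constant [K] depends on [f] alone; this uniformity in [q] later bounds remainders depending
    on a complex increment. *)
Lemma cintegral_bound D f : open D ->
  measurable (D : set (measurableTypeR R)) -> cintegrable D f ->
  exists K : R, forall q (M : R), bounded_cont D q ->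
    (forall t, D t -> `|q t| <= M%:C) ->
    `|cintegral D (fun t => q t * f t)| <= (M * K)%:C.
Proof.
move=> oD mD fi; have [f1 f2] := fi.
have f1n := integrable_norm f1.
have f2n := integrable_norm f2.
pose I := \int[mu]_(t in D) (`|complex.Re (f t)| + `|complex.Im (f t)|).
(* Each of the two components of the integral is at most [M * I]. *)
exists (I *+ 2) => q M qb qM.
have [i1 i2] := bounded_cont_integrable oD mD qb fi.
apply: (le_trans (normr_complex_le _)); rewrite lecR mulrnAr mulr2n /=.
have iI : mu.-integrable D
  (EFin \o (fun t => M * (`|complex.Re (f t)| + `|complex.Im (f t)|))).
  by apply: integrable_mull => //; exact: (integrableD mD f1n f2n).
rewrite -RintegralZl//; last exact: (integrableD mD f1n f2n).
apply: lerD; (apply: le_trans; [exact: le_normr_Rintegral|]).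
- apply: le_Rintegral => //; first exact: integrable_norm i1.
  move=> t Dt; rewrite ReM (le_trans (ler_normB _ _))// !normrM mulrDr.
  apply: lerD; apply: ler_wpM2r => //.
    exact: normr_Re_le (qM t Dt).
  exact: normr_Im_le (qM t Dt).
- apply: le_Rintegral => //; first exact: integrable_norm i2.
  move=> t Dt; rewrite ImM (le_trans (ler_normD _ _))// !normrM mulrDr addrC.
  apply: lerD; apply: ler_wpM2r => //.
    exact: normr_Im_le (qM t Dt).
  exact: normr_Re_le (qM t Dt).
Qed.

End ComplexIntegrals.

(** * Limits of complex-valued functions, componentwise and through the modulus *)

Section ComplexLimits.
Variable R : realType.
Variable F : set_system R.
Context {FF : Filter F}.
Implicit Types (g q : R -> R[i]) (z w : R[i]).

Lemma ccvgP g z :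
  ccvg F g z <-> forall e : R, 0 < e -> \forall x \near F, `|g x - z| <= e%:C.
Proof.
split=> [[g1 g2] e e0|gz].
- have e20 : 0 < e / 2 by rewrite divr_gt0.
  move/cvgrPdist_le/(_ _ e20) : g1 => g1; move/cvgrPdist_le/(_ _ e20) : g2 => g2.
  near=> x; apply: (le_trans (normr_complex_le _)); rewrite lecR.
  rewrite ReD ImD ReN ImN (splitr e) lerD// distrC.
    by near: x.
  by near: x.
- split; apply/cvgrPdist_le => e e0; apply: filterS (gz _ e0) => x.
  + by move=> /normr_Re_le; rewrite ReD ReN distrC.
  + by move=> /normr_Im_le; rewrite ImD ImN distrC.
Unshelve. all: by end_near. Qed.

Lemma ccvg0_bounded q g (M : R) : (\forall x \near F, `|q x| <= M%:C) ->
  ccvg F g 0 -> ccvg F (fun x => q x * g x) 0.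
Proof.
move=> qM /ccvgP g0; apply/ccvgP => e e0.
(* This replaces [M] by a larger bound that is certainly positive, so that it can divide [e]. *)
have M0 : 0 < `|M| + 1 by rewrite ltr_wpDl.
have e1 : 0 < e / (`|M| + 1) by rewrite divr_gt0.
near=> x; rewrite subr0 normrM.
have -> : e = (`|M| + 1) * (e / (`|M| + 1)) by rewrite mulrCA divff ?mulr1// gt_eqF.
rewrite rmorphM ler_pM//.
- apply: (@le_trans _ _ M%:C); first by near: x.
  by rewrite lecR (le_trans (ler_norm _))// lerDl.
- by rewrite -[g x]subr0; near: x; exact: g0.
Unshelve. all: by end_near. Qed.

Lemma ccvg_away0 g z : ccvg F g z -> z != 0 ->
  exists2 d : R, 0 < d & \forall x \near F, d%:C <= `|g x|.
Proof.
move=> /ccvgP gz; rewrite -normr_gt0 normc_def => r0.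
move: gz; set r := Num.sqrt _ in r0 * => gz; rewrite ltcR in r0.
have r20 : 0 < r / 2 by rewrite divr_gt0.
exists (r / 2) => //; apply: filterS (gz _ r20) => x.
have zE : `|z| = r%:C by rewrite normc_def.
move=> gxz; have := lerB_dist z (g x); rewrite zE distrC => rg.
have : r%:C - `|g x| <= (r / 2)%:C by exact: le_trans gxz.
by rewrite lerBlDr -lerBlDl -rmorphB /=; congr (_ <= _); congr (_ %:C); field.
Qed.
End ComplexLimits.

Lemma ccvg_unique (R : realType) (F : set_system R) (FF : ProperFilter F)
    (g : R -> R[i]) (z w : R[i]) : ccvg F g z -> ccvg F g w -> z = w.
Proof.
move=> [g1 g2] [h1 h2].
by apply: complexP; [apply: cvg_unique g1 h1|apply: cvg_unique g2 h2].
Qed.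

(** * Integration by parts against the weight *)

Section IntegrationByParts.
Variable R : realType.
Variables (g g1 E : R -> R[i]) (s : seq R) (a b : R[i]).
Let D : set R := `]0, 1[.
Hypothesis bg : bounded_cont D g.
Hypothesis g0 : forall t, D t -> g t != 0.
Hypothesis lim0 : ccvg 0^'+ g 0.
Hypothesis lim1 : ccvg 1^'- g 0.
Hypothesis dg : forall t, D t -> t \notin s -> cderiv g t (g1 t).
Hypothesis cg1 : forall t, D t -> t \notin s -> ccont g1 t.
Hypothesis cE : forall t, D t -> ccont E t.
Hypothesis E0 : forall t, D t -> E t != 0.
(** The equation [z^2 W' = ((a - 2) z + b) W] pulled back along the path [g], where [g1] is the path
    derivative and [E] the weight at [g t]. *)
Hypothesis dE : forall t, D t -> t \notin s ->
  cderiv E t (((a - 2) * g t + b) / g t ^+ 2 * g1 t * E t).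
Hypothesis iE : cintegrable D (fun t => E t * g1 t).

Let mD : measurable (D : set (measurableTypeR R)). Proof. exact: measurable_itv. Qed.
Let oD : open D. Proof. exact: interval_open. Qed.

Let cg t : D t -> ccont g t. Proof. by case: bg => + _; apply. Qed.

(** This is [z^2 W] along the path, the factor of the boundary terms; its derivative is the Pearson
    equation. *)
Let G t := g t * g t * E t.

Let cG t : D t -> ccont G t.
Proof. by move=> Dt; apply: ccontM; [apply: ccontM; exact: cg|exact: cE]. Qed.

Let dG t : D t -> t \notin s -> cderiv G t ((a * g t + b) * (E t * g1 t)).
Proof.
move=> Dt ts.
have := cderivM (cderivM (dg Dt ts) (dg Dt ts)) (dE Dt ts).
by congr cderiv; field; exact: g0.
Qed.

(* Near an end where [G] stays away from 0, [g1 / g ^+ 2 = E * g1 / G] is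
   integrable, so its primitive [- g^-1] converges there; this is absurd when
   [g] tends to 0, whence [weight_vanishes]. *)
Lemma path_inv_cvg (c d e : R) : 0 <= c -> c < d -> d <= 1 -> 0 < e ->
  (forall t, t \in `]c, d[ -> e%:C <= `|G t|) ->
  exists l l' : R[i],
    ccvg c^'+ (fun t => (g t)^-1) l /\ ccvg d^'- (fun t => (g t)^-1) l'.
Proof.
move=> c0 cd d1 e0 eG.
have sD t : t \in `]c, d[ -> D t.
  rewrite /D/= !in_itv/= => /andP[ct td].
  by rewrite (le_lt_trans c0)//= (lt_le_trans td).
have oI : open (`]c, d[%classic : set R) by exact: interval_open.
have mI : measurable (`]c, d[%classic : set (measurableTypeR R)).
  exact: measurable_itv.
have bG : bounded_cont `]c, d[ (fun t => (G t)^-1).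
  by apply: (bounded_contV e0) => t tI; [exact/cG/sD|exact: eG].
have iI : cintegrable `]c, d[ (fun t => E t * g1 t).
  by case: iE => i1 i2; split; [apply: integrableS i1|apply: integrableS i2].
have iJ := bounded_cont_integrable oI mI (bounded_contN bG) iI.
have JE t : t \in `]c, d[ -> - (G t)^-1 * (E t * g1 t) = - (g1 t / g t ^+ 2).
  move=> tI; have := g0 (sD _ tI); have := E0 (sD _ tI).
  by move=> ? ?; rewrite /G; field; apply/andP.
have iJ' : cintegrable `]c, d[ (fun t => - (g1 t / g t ^+ 2)).
  by apply: (eq_cintegrable mI) iJ => t; exact: JE.
have [l [h1 h2]] : exists l : R[i], ccvg c^'+ (fun t => (g t)^-1) l /\
    ccvg d^'- (fun t => (g t)^-1)
      (l + cintegral `]c, d[ (fun t => - (g1 t / g t ^+ 2))).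
  apply: (complex_FTC (s := s) cd iJ') => t /sD Dt.
  - by apply: ccontV; auto.
  - by move=> ts; apply: cderivV; auto.
  - move=> ts; apply/ccontN/ccontM; first by auto.
    apply: ccontV; first by rewrite expf_neq0// g0.
    under [X in ccont X]funext do rewrite expr2.
    by apply: ccontM; auto.
by exists l, (l + cintegral `]c, d[ (fun t => - (g1 t / g t ^+ 2))).
Qed.

(** If [g^-1] converged it would be bounded, and the constant [g^-1 * g = 1] would tend to 0 with
    [g]. *)
Lemma path_inv_diverges (F : set_system R) (FF : ProperFilter F) l :
  (\forall t \near F, D t) -> ccvg F g 0 ->
  ~ ccvg F (fun t => (g t)^-1) l.
Proof.
move=> FD gF gl.
have [M lM] : exists M : R, \forall t \near F, `|(g t)^-1| <= M%:C.
  exists (Num.sqrt (complex.Re l ^+ 2 + complex.Im l ^+ 2) + 1).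
  move/ccvgP/(_ _ ltr01) : gl; apply: filterS => t h.
  rewrite rmorphD /= -normc_def -[X in `|X|](subrK l) addrC.
  by rewrite (le_trans (ler_normD _ _))// lerD.
have : ccvg F (fun t => (g t)^-1 * g t) 0 by exact: ccvg0_bounded lM gF.
move=> /ccvgP/(_ (2^-1)); rewrite invr_gt0 ltr0n => /(_ isT) h.
have [t [Dt]] := filter_ex (filterI FD h).
rewrite mulVf ?g0// subr0 normr1 lecR.
by move=> ?; lra.
Qed.

Lemma weight_vanishes : ccvg 0^'+ G 0 /\ ccvg 1^'- G 0.
Proof.
have bq : bounded_cont D (fun t => a * g t + b).
  apply: bounded_contD; last exact: bounded_cont_cst.
  by apply: bounded_contM => //; exact: bounded_cont_cst.
have iG := bounded_cont_integrable oD mD bq iE.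
(* The derivative of [G] is integrable, so [G] has a limit at each end; what remains is to exclude
   nonzero limits. *)
have [l [l0 l1]] : exists l : R[i], ccvg 0^'+ G l /\
    ccvg 1^'- G (l + cintegral D (fun t => (a * g t + b) * (E t * g1 t))).
  apply: (complex_FTC (s := s) ltr01 iG) => // t Dt ts.
  apply: ccontM; first by case: bq => + _; apply.
  by apply: ccontM; auto.
move: l1; set l' := l + _ => l1.
split.
- have [<-//|lN0] := eqVneq l 0.
  have [e e0 eG] := ccvg_away0 l0 lN0.
  have [d /= d0 dG'] : exists2 d : R, 0 < d &
      forall t, t \in `]0, d[ -> e%:C <= `|G t|.
    move: eG => [d /= d0 dP]; exists d => // t; rewrite in_itv/= => /andP[t0 td].
    by apply: dP => //=; rewrite sub0r normrN gtr0_norm.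
  (* The minimum with 1 keeps the interval on which [G] is bounded below inside the domain. *)
  have m0 : 0 < Num.min d 1 by rewrite lt_min d0 ltr01.
  have m1 : Num.min d 1 <= 1 by rewrite ge_min lexx orbT.
  have [|k [k' [kl _]]] := path_inv_cvg (lexx 0) m0 m1 e0.
    move=> t; rewrite in_itv/= lt_min => /and3P[t0 td _].
    by apply: dG'; rewrite in_itv/= t0.
  exfalso; apply: path_inv_diverges lim0 kl.
  near=> t; rewrite /D/= in_itv/=; apply/andP; split; near: t.
    exact: nbhs_right_gt.
  exact: nbhs_right_lt.
- have [<-//|lN0] := eqVneq l' 0.
  have [e e0 eG] := ccvg_away0 l1 lN0.
  have [d /= d0 dG'] : exists2 d : R, 0 < d &
      forall t, t \in `](1 - d), 1[ -> e%:C <= `|G t|.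
    move: eG => [d /= d0 dP]; exists d => // t; rewrite in_itv/= => /andP[t0 td].
    by apply: dP => //=; rewrite gtr0_norm ?subr_gt0// ltrBlDr -ltrBlDl.
  have m1 : Num.max (1 - d) 0 < 1 by rewrite gt_max ltr01 ltrBlDr ltrDl d0.
  have m0 : 0 <= Num.max (1 - d) 0 by rewrite le_max lexx orbT.
  have [|k [k' [_ kl]]] := path_inv_cvg m0 m1 (lexx 1) e0.
    move=> t; rewrite in_itv/= gt_max => /andP[/andP[t0 td] t1].
    by apply: dG'; rewrite in_itv/= t0.
  exfalso; apply: path_inv_diverges lim1 kl.
  near=> t; rewrite /D/= in_itv/=; apply/andP; split; near: t.
    exact: nbhs_left_gt.
  exact: nbhs_left_lt.
Unshelve. all: by end_near. Qed.

(** The integrand is the derivative of [q * G], where [q1] is the derivative of [q] with respect to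
    the complex variable. Since [q] is bounded and [G] vanishes at both ends, so does the
    product. *)
Lemma path_integration_by_parts (q q1 : R -> R[i]) :
  bounded_cont D q -> bounded_cont D q1 ->
  (forall t, D t -> t \notin s -> cderiv q t (q1 t * g1 t)) ->
  cintegral D (fun t => (g t ^+ 2 * q1 t + (a * g t + b) * q t) * (E t * g1 t)) = 0.
Proof.
move=> bq bq1 dq.
have bh : bounded_cont D (fun t => g t ^+ 2 * q1 t + (a * g t + b) * q t).
  apply: bounded_contD; apply: bounded_contM => //.
    under [X in bounded_cont D X]funext do rewrite expr2.
    exact: bounded_contM.
  apply: bounded_contD; last exact: bounded_cont_cst.
  by apply: bounded_contM => //; exact: bounded_cont_cst.
have ih := bounded_cont_integrable oD mD bh iE.
have [l [l0 l1]] : exists l : R[i], ccvg 0^'+ (fun t => q t * G t) l /\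
    ccvg 1^'- (fun t => q t * G t) (l + cintegral D
      (fun t => (g t ^+ 2 * q1 t + (a * g t + b) * q t) * (E t * g1 t))).
  apply: (complex_FTC (s := s) ltr01 ih) => t Dt.
  - by apply: ccontM; [case: bq => + _; apply|exact: cG].
  - move=> ts; have := cderivM (dq _ Dt ts) (dG Dt ts).
    by congr cderiv; rewrite /G; ring.
  - move=> ts; apply: ccontM; first by case: bh => + _; apply.
    by apply: ccontM; auto.
have [G0 G1] := weight_vanishes.
have [M qM] := bq.2.
(* The limit at the start is 0, so the limit at the other end is the integral itself. *)
have l00 : l = 0.
  apply: ccvg_unique l0 _; apply: (ccvg0_bounded (M := M)) G0.
  near=> t; apply: qM; rewrite /D/= in_itv/=; apply/andP; split; near: t.
    exact: nbhs_right_gt.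
  exact: nbhs_right_lt.
have := l1; rewrite l00 add0r => {}l1.
apply: ccvg_unique l1 _; apply: (ccvg0_bounded (M := M)) G1.
near=> t; apply: qM; rewrite /D/= in_itv/=; apply/andP; split; near: t.
  exact: nbhs_left_gt.
exact: nbhs_left_lt.
Unshelve. all: by end_near. Qed.

End IntegrationByParts.

(** * Complex differentiability from a quadratic remainder *)

Section ComplexDerivative.
Variable R : realType.

(** The difference quotient is within [|w| * C] of [l]. The criterion suits integrals of Cauchy
    kernels, whose Taylor remainders are explicit. *)
Lemma is_derive_quadratic (f : R[i]^o -> R[i]^o) (z l : R[i]^o) (d C : R) :
  0 < d -> 0 <= C ->
  (forall w : R[i], `|w| <= d%:C ->
    `|f (z + w) - f z - w * l| <= `|w| ^+ 2 * C%:C) ->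
  is_derive z 1 f l.
Proof.
move=> d0 C0 fC.
have fl : (fun h : R[i] => h^-1 *: ((f \o shift z) (h *: (1 : R[i]^o)) - f z))
    @ (dnbhs (0 : R[i]^o) : set_system R[i]) --> l.
  apply/cvgrPdist_le => e e0.
  (* Adding 1 allows the division when [C] is 0. *)
  have C1 : 0 < (C + 1)%:C by rewrite ltcR ltr_wpDl.
  have e1 : 0 < e / (C + 1)%:C by rewrite divr_gt0.
  have d0' : 0 < d%:C by rewrite ltcR.
  near=> h.
  have h0 : h != 0 by near: h; exact: withinT.
  have hd : `|h| <= d%:C by near: h; exact: (@dnbhs0_le _ R[i]^o).
  have he : `|h| <= e / (C + 1)%:C by near: h; exact: (@dnbhs0_le _ R[i]^o).
  rewrite distrC -(ler_pM2l (_ : 0 < `|h|)) ?normr_gt0// -normrM mulrBr.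
  rewrite -[h^-1 *: _]/(h^-1 * _) mulVKf//= -[h *: 1]/(h * 1) mulr1 [h + z]addrC.
  apply: (le_trans (fC _ hd)).
  rewrite expr2 -mulrA ler_pM2l ?normr_gt0//.
  move: he; rewrite ler_pdivlMr//; apply: le_trans.
  by rewrite ler_wpM2l// lecR lerDl.
apply: DeriveDef; first by apply/cvg_ex; exists l.
exact/cvg_lim.
Unshelve. all: by end_near. Qed.

End ComplexDerivative.

(** * The Bessel operator *)

Section BesselOperator.
Variable R : comNzRingType.
Variables a b : R.
Implicit Types p q : {poly R}.

Definition bessel_op p : {poly R} :=
  'X^2 * p^`(2) + (a%:P * 'X + b%:P) * p^`().

(** In the monomial basis the operator is bidiagonal: its eigenvalues [i (a + i - 1)] are on the
    diagonal, and the other entries only lower the degree by one. *)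
Lemma coef_bessel_op p i : (bessel_op p)`_i =
  (i%:R * (a + i%:R - 1)) * p`_i + b * (p`_i.+1 *+ i.+1).
Proof.
rewrite /bessel_op mulrDl -mulrA !coefD coefXnM coef_derivn !coefCM coefXM.
rewrite !coef_deriv; case: i => [|[|i]] /=.
- by rewrite mulr0 add0r !mul0r !add0r.
- by ring.
- rewrite subn2 /= add2n ffactnS ffactn1 /=.
  by ring.
Qed.

Lemma size_bessel_op p : (size (bessel_op p) <= size p)%N.
Proof.
apply/leq_sizeP => j jp; rewrite coef_bessel_op !nth_default ?(leqW jp)//.
by rewrite mul0rn !mulr0 addr0.
Qed.

(** The diagonal entry at [n] is the subtracted scalar, so the leading coefficient cancels. *)
Lemma size_bessel_op_eigen p n : size p = n.+1 ->
  (size (bessel_op p - (n%:R * (a + n%:R - 1)) *: p)%R <= n)%N.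
Proof.
move=> sp; apply/leq_sizeP => j nj.
rewrite coefB coefZ coef_bessel_op.
rewrite [p`_j.+1]nth_default ?sp// mul0rn mulr0 addr0.
move: nj; rewrite leq_eqVlt => /predU1P[->|nj]; first by rewrite subrr.
by rewrite nth_default ?sp// !mulr0 subrr.
Qed.

(** The defect of symmetry has the shape [z^2 q' + (a z + b) q] that integrates to 0 against the
    weight, with the Wronskian in place of [q]. *)
Lemma bessel_op_wronskian p q : bessel_op p * q - p * bessel_op q =
  'X^2 * (p^`() * q - p * q^`())^`() +
  (a%:P * 'X + b%:P) * (p^`() * q - p * q^`()).
Proof.
have d2 (r : {poly R}) : r^`(2) = r^`()^`() by [].
by rewrite /bessel_op derivB !derivM !d2; ring.
Qed.

End BesselOperator.

Lemma det_neq0_mul0 (K : fieldType) n (A : 'M[K]_n) (v : 'rV[K]_n) :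
  \det A != 0 -> v *m A = 0 -> v = 0.
Proof.
move=> dA vA; have uA : A \in unitmx by rewrite unitmxE unitfE.
by rewrite -[v](mulmxK uA) vA mul0mx.
Qed.

(** * Compactness of the path: boundedness, distance to a point, end limits *)

Section ClosedPath.
Variable R : realType.
Variable g : R -> R[i].
Hypothesis cg : {within `[0, 1], continuous (g : R -> R[i]^o)}.

Lemma within_Re_Im :
  {within `[0, 1], continuous (fun t => complex.Re (g t))} /\
  {within `[0, 1], continuous (fun t => complex.Im (g t))}.
Proof. by split=> x; have /cvg_complex[] := @cg x. Qed.

(** The squared distance is real-valued, so the extreme value theorem applies to it. *)
Let sqr_dist z t :=
  complex.Re (g t - z) ^+ 2 + complex.Im (g t - z) ^+ 2.

Let csqr_dist z : {within `[0, 1], continuous (sqr_dist z)}.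
Proof.
have [c1 c2] := within_Re_Im.
have -> : sqr_dist z = fun t =>
    (complex.Re (g t) - complex.Re z) * (complex.Re (g t) - complex.Re z) +
    (complex.Im (g t) - complex.Im z) * (complex.Im (g t) - complex.Im z).
  by apply: funext => t; rewrite /sqr_dist ReD ImD ReN ImN !expr2.
move=> x; apply: cvgD; apply: cvgM; (apply: cvgB; [|exact: cvg_cst]).
- exact: c1.
- exact: c1.
- exact: c2.
- exact: c2.
Qed.

Lemma path_bounded :
  exists M : R, forall t, t \in `[0, 1] -> `|g t| <= M%:C.
Proof.
have [c _ cM] := EVT_max (@ler01 R) (csqr_dist (z := 0)).
exists (Num.sqrt (sqr_dist 0 c)) => t tI; rewrite normc_def lecR ler_wsqrtr//.
by have := cM _ tI; rewrite {1}/sqr_dist subr0.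
Qed.

Lemma path_off_trace z : ~ trace g z ->
  exists2 d : R, 0 < d & forall t, t \in `[0, 1] -> d%:C <= `|g t - z|.
Proof.
move=> gz; have [c cI cM] := EVT_min (@ler01 R) (csqr_dist (z := z)).
exists (Num.sqrt (sqr_dist z c)).
  rewrite sqrtr_gt0 lt_neqAle addr_ge0 ?sqr_ge0// andbT eq_sym.
  apply: sqr_modulus_neq0; apply/eqP => /eqP; rewrite subr_eq0 => /eqP gcz.
  by apply: gz; exists c.
by move=> t tI; rewrite normc_def lecR ler_wsqrtr// cM.
Qed.

Lemma path_ccont t : t \in `]0, 1[ -> ccont g t.
Proof.
have [/(continuous_within_itvP _ ltr01)[c1 _ _]
  /(continuous_within_itvP _ ltr01)[c2 _ _]] := within_Re_Im.
by move=> tI; split; [exact: c1|exact: c2].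
Qed.

Lemma path_cvg_ends : ccvg 0^'+ g (g 0) /\ ccvg 1^'- g (g 1).
Proof.
by have [/(continuous_within_itvP _ ltr01)[_ ? ?]
  /(continuous_within_itvP _ ltr01)[_ ? ?]] := within_Re_Im.
Qed.

End ClosedPath.

(** * The Bessel weight along the loop and integration against it *)

Section BesselPolynomials.
Variable R : realType.
Variables (g : R -> R[i]) (lg : R[i] -> R[i]) (a : R) (b : R[i]).
Let W := bessel_weight lg a b.
Let D : set R := `]0, 1[.
Variable s : seq R.
Hypothesis cg : {within `[0, 1], continuous (g : R -> R[i]^o)}.
Hypothesis dg : forall t, D t -> t \notin s ->
  cderiv g t (path_deriv g t) /\ ccont (path_deriv g) t.
Hypotheses (g0 : g 0 = 0) (g1 : g 1 = 0).
Hypothesis hlg : log_branch_along g lg.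
Hypothesis hW : regular_weight g W.

Let Phi t := W (g t) * path_deriv g t.
(** The integral of [q W dz], without the factor [1 / (2 pi i)]. Its argument is a function of the
    parameter, so that polynomials and Cauchy kernels are treated alike. *)
Let J (q : R -> R[i]) := cintegral D (fun t => q t * Phi t).

Let mD : measurable (D : set (measurableTypeR R)). Proof. exact: measurable_itv. Qed.
Let oD : open D. Proof. exact: interval_open. Qed.
Let DI t : D t -> t \in `[0, 1]. Proof. exact: subset_itv_oo_cc. Qed.

(** This is the existence of the moment of order 0; it makes [q * Phi] integrable for every [q] in
    [bounded_cont D]. *)
Let iPhi : cintegrable D Phi.
Proof.
by have := hW.1 0%N; apply: (eq_cintegrable mD) => t _; rewrite expr0 mul1r.
Qed.

Let g_neq0 t : D t -> g t != 0.
Proof. by move=> Dt; have [<- _] := hlg Dt; exact: cexp_neq0. Qed.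

Let bg : bounded_cont D g.
Proof.
split=> [t|]; first exact: path_ccont.
by have [M gM] := path_bounded cg; exists M => t /DI; exact: gM.
Qed.

Let clg t : D t -> ccont (fun u => lg (g u)) t.
Proof. by move=> Dt; have [_ /ccontP] := hlg Dt. Qed.

Let cW t : D t -> ccont (fun u => W (g u)) t.
Proof.
move=> Dt; apply: ccontM; apply: ccont_cexp; apply: ccontM.
- exact: ccont_cst.
- exact: clg.
- exact: ccont_cst.
- by apply: ccontV; [exact: g_neq0|case: bg => + _; apply].
Qed.

Let dW t : D t -> t \notin s -> cderiv (fun u => W (g u)) t
  (((a%:C - 2) * g t + b) / g t ^+ 2 * path_deriv g t * W (g t)).
Proof.
move=> Dt ts; have [dgt _] := dg Dt ts.
have dlg : cderiv (fun u => lg (g u)) t (path_deriv g t / g t).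
  (* [lg] is only known as a continuous logarithm along the loop; its derivative [dz / z] is deduced
     from that. *)
  apply: cderiv_log dgt; last exact: clg.
  have := near_in_itvoo Dt; apply: filterS => u uD.
  by have [] := hlg uD.
have d1 := cderiv_cexp (cderivM (cderiv_cst (a - 2)%:C t) dlg).
have d2 := cderiv_cexp (cderivM (cderiv_cst (- b) t) (cderivV (g_neq0 Dt) dgt)).
have := cderivM d1 d2; congr cderiv.
rewrite /W /bessel_weight rmorphB /= -[2%:C]/(2%:R%:C) rmorph_nat.
by field; exact: g_neq0.
Qed.

Let J_ibp (q q1 : R -> R[i]) :
  bounded_cont D q -> bounded_cont D q1 ->
  (forall t, D t -> t \notin s -> cderiv q t (q1 t * path_deriv g t)) ->
  J (fun t => g t ^+ 2 * q1 t + (a%:C * g t + b) * q t) = 0.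
Proof.
have [l0 l1] := path_cvg_ends cg; rewrite g0 g1 in l0 l1.
apply: (@path_integration_by_parts _ g (path_deriv g) (fun t => W (g t)) s) => //.
- by move=> t Dt ts; have [] := dg Dt ts.
- by move=> t Dt ts; have [] := dg Dt ts.
- by move=> t Dt; rewrite mulf_neq0// cexp_neq0.
Qed.

Let JD q h : bounded_cont D q -> bounded_cont D h ->
  J (fun t => q t + h t) = J q + J h.
Proof.
move=> bq bh; rewrite /J -cintegralD//; try exact: bounded_cont_integrable.
by apply: eq_cintegral => t _; rewrite mulrDl.
Qed.

Let JZ z q : bounded_cont D q -> J (fun t => z * q t) = z * J q.
Proof.
move=> bq; rewrite /J -cintegralZ//; last exact: bounded_cont_integrable.
by apply: eq_cintegral => t _; rewrite mulrA.
Qed.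

Let eq_J q h : (forall t, D t -> q t = h t) -> J q = J h.
Proof. by move=> qh; apply: eq_cintegral => t Dt; rewrite qh. Qed.

Let bpoly (p : {poly R[i]}) : bounded_cont D (fun t => p.[g t]).
Proof.
elim/poly_ind: p => [|p c IH].
  by under [X in bounded_cont D X]funext do rewrite horner0; exact: bounded_cont_cst.
under [X in bounded_cont D X]funext do rewrite hornerMXaddC.
by apply: bounded_contD; [exact: bounded_contM|exact: bounded_cont_cst].
Qed.

Let dpoly (p : {poly R[i]}) t : D t -> t \notin s ->
  cderiv (fun u => p.[g u]) t (p^`().[g t] * path_deriv g t).
Proof.
move=> Dt ts; have [dgt _] := dg Dt ts.
elim/poly_ind: p => [|p c IH].
  under [X in cderiv X]funext do rewrite horner0.
  by rewrite deriv0 horner0 mul0r; exact: cderiv_cst.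
under [X in cderiv X]funext do rewrite hornerMXaddC.
have := cderivD (cderivM IH dgt) (cderiv_cst c t).
by congr cderiv; rewrite derivMXaddC hornerD hornerM hornerX; ring.
Qed.

(** * The pairing [B (p * q)] and the eigenvalue equation of the orthogonal polynomials *)

Let B (p : {poly R[i]}) := J (fun t => p.[g t]).

Let BD p q : B (p + q) = B p + B q.
Proof. by rewrite /B -JD//; apply: eq_J => t _; rewrite hornerD. Qed.

Let BZ z p : B (z *: p) = z * B p.
Proof. by rewrite /B -JZ//; apply: eq_J => t _; rewrite hornerZ. Qed.

Let B_sum n (F : 'I_n -> {poly R[i]}) : B (\sum_i F i) = \sum_i B (F i).
Proof.
elim/big_ind2 : _ => [|? ? ? ? <- <-|//]; last exact: BD.
by rewrite -(scale0r (0 : {poly R[i]})) BZ mul0r.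
Qed.

Let two_pi_i_neq0 : two_pi_i R != 0.
Proof.
apply/eqP => -[/eqP]; rewrite mulrn_eq0 /= => /eqP pi0.
by have := pi_gt0 R; rewrite pi0 ltxx.
Qed.

Let momentE n : moment g W n = B 'X^n / two_pi_i R.
Proof.
congr (_ / _); apply: eq_cintegral => t _.
by rewrite hornerXn -mulrA.
Qed.

Let T := bessel_op a%:C b.

Let T_sym p q : B (T p * q) = B (p * T q).
Proof.
apply/eqP; rewrite -subr_eq0 -mulN1r -BZ -BD scaleN1r bessel_op_wronskian.
apply/eqP; rewrite -(J_ibp (q := fun t => (p^`() * q - p * q^`()).[g t])
  (q1 := fun t => (p^`() * q - p * q^`())^`().[g t]))//; last exact: dpoly.
by apply: eq_J => t _; rewrite !hornerE.
Qed.

Let B_orth n p (r : {poly R[i]}) :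
  monic_orthogonal g W n p -> (size r <= n)%N -> B (p * r) = 0.
Proof.
move=> [_ _ [c _ pX]] rn.
have Bk k : (k < n)%N -> B (p * 'X^k) = 0.
  move=> kn; have := pX k (ltnW kn); rewrite gtn_eqF// mul0r => /eqP.
  rewrite mulf_eq0 invr_eq0 (negbTE two_pi_i_neq0) orbF => /eqP <-.
  by apply: eq_cintegral => t _; rewrite hornerM hornerXn /Phi; ring.
rewrite -[r]coefK poly_def mulr_sumr B_sum big1// => i _.
by rewrite -scalerAr BZ Bk ?mulr0// (leq_trans (ltn_ord i)).
Qed.

(** The hypotheses say that the row of coefficients of [r] is annihilated by the Hankel matrix of
    moments, which is invertible by regularity. *)
Let B_inj n (r : {poly R[i]}) : (size r <= n)%N ->
  (forall k, (k < n)%N -> B (r * 'X^k) = 0) -> r = 0.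
Proof.
(* The determinant of index [n] has size [n.+1], so the bound 0 is treated apart: it forces
   [r = 0]. *)
case: n => [|n]; first by rewrite leqn0 size_poly_eq0 => /eqP.
move=> rn rX; pose v : 'rV[R[i]]_n.+1 := \row_j r`_j.
suff v0 : v = 0.
  apply/polyP => i; rewrite coef0; have [ni|ni] := leqP n.+1 i.
    by rewrite nth_default// (leq_trans rn).
  by have := congr1 (fun w : 'rV__ => w 0 (Ordinal ni)) v0; rewrite !mxE.
apply: det_neq0_mul0 (hW.2 n) _; apply/rowP => k; rewrite !mxE.
have rE : r = \sum_(j < n.+1) r`_j *: 'X^j.
  rewrite -poly_def; apply/polyP => i; rewrite coef_poly.
  by case: ltnP => // ni; rewrite nth_default// (leq_trans rn).
have := rX k (ltn_ord k); rewrite {1}rE mulr_suml B_sum.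
move=> /(congr1 (fun x => x / two_pi_i R)).
rewrite mul0r mulr_suml => rk; rewrite -[RHS]rk; apply: eq_bigr => j _.
by rewrite !mxE momentE -scalerAl BZ exprD mulrA.
Qed.

Lemma bessel_op_orthogonal n p : monic_orthogonal g W n p ->
  T p = (n%:R * (a%:C + n%:R - 1)) *: p.
Proof.
move=> op; have [_ sp _] := op.
apply/eqP; rewrite -subr_eq0; apply/eqP/(@B_inj n).
  exact: size_bessel_op_eigen.
(* Symmetry moves [T] onto ['X^k], which it keeps at degree below [n]; both terms then vanish by
   orthogonality. *)
move=> k kn; rewrite mulrBl -scalerAl -scaleN1r scalerA BD BZ T_sym.
have sX : (size ('X^k : {poly R[i]}) <= n)%N by rewrite size_polyXn.
by rewrite !(B_orth op) ?mulr0 ?addr0// (leq_trans (size_bessel_op _ _ _)).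
Qed.

(** * The Cauchy kernel [1 / (zeta - z)] on the loop and the functions of the second kind *)

Let hz z t := (g t - z)^-1.

Let chz z t : ~ trace g z -> D t -> g t - z != 0.
Proof.
move=> gz Dt; rewrite subr_eq0; apply/eqP => gtz; apply: gz; exists t => //.
exact: DI.
Qed.

Let bgz z : bounded_cont D (fun t => g t - z).
Proof. by apply: bounded_contD => //; exact: bounded_cont_cst. Qed.

Let hz_bound z (d : R) : 0 < d -> (forall t, D t -> d%:C <= `|g t - z|) ->
  bounded_cont D (hz z) /\ forall t, D t -> `|hz z t| <= d^-1%:C.
Proof.
move=> d0 dz; split.
  by apply: (bounded_contV d0) => // t Dt; have [+ _] := bgz z; apply.
move=> t Dt; have d0' : 0 < d%:C by rewrite ltcR.
have gz0 : 0 < `|g t - z| by exact: lt_le_trans (dz _ Dt).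
by rewrite /hz normfV fmorphV lef_pV2 ?posrE// dz.
Qed.

Let bhz z : ~ trace g z -> bounded_cont D (hz z).
Proof.
move=> /(path_off_trace cg)[d d0 dz].
by have [] := hz_bound d0 (fun t Dt => dz t (DI Dt)).
Qed.

Let dhz z t : ~ trace g z -> D t -> t \notin s ->
  cderiv (hz z) t (- (hz z t * hz z t) * path_deriv g t).
Proof.
move=> gz Dt ts; have [dgt _] := dg Dt ts.
have := cderivV (chz gz Dt) (cderivD dgt (cderiv_cst (- z) t)).
by congr cderiv; rewrite /hz; field; exact: chz.
Qed.

(** A pointwise expansion of the kernel to first order in [w] can be integrated: the factor [r w] is
    bounded uniformly in [w], hence so is its integral, and [w ^+ 2] comes out. *)
Let J_quadratic (k r : R[i] -> R -> R[i]) (k' : R -> R[i]) (d M : R) (z : R[i]) :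
  0 < d -> bounded_cont D k' ->
  (forall w, `|w| <= d%:C -> bounded_cont D (k (z + w)) /\ bounded_cont D (r w)) ->
  (forall w t, `|w| <= d%:C -> D t -> `|r w t| <= M%:C) ->
  (forall w t, `|w| <= d%:C -> D t ->
     k (z + w) t - k z t - w * k' t = w ^+ 2 * r w t) ->
  exists2 C : R, 0 <= C & forall w, `|w| <= d%:C ->
    `|J (k (z + w)) / two_pi_i R - J (k z) / two_pi_i R - w * (J k' / two_pi_i R)|
      <= `|w| ^+ 2 * C%:C.
Proof.
move=> d0 bk' bkr rM kE.
have [K KP] := cintegral_bound oD mD iPhi.
have [c c0 tauE] : exists2 c : R, 0 <= c & `|(two_pi_i R)^-1| = c%:C.
  by rewrite normc_def; eexists; last by []; exact: sqrtr_ge0.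
(* The absolute value makes the constant nonnegative whatever the signs of [M] and [K]. *)
exists (`|M * K| * c); first by rewrite mulr_ge0.
have z0 : `|0 : R[i]| <= d%:C by rewrite normr0 lecR ltW.
have [bkz _] := bkr _ z0; rewrite addr0 in bkz.
move=> w wd; have [bk br] := bkr _ wd.
have b1 := bounded_contM (bounded_cont_cst D (-1)) bkz.
have b2 := bounded_contM (bounded_cont_cst D (- w)) bk'.
have -> : J (k (z + w)) / two_pi_i R - J (k z) / two_pi_i R -
    w * (J k' / two_pi_i R) = w ^+ 2 * (J (r w) / two_pi_i R).
  suff : J (k (z + w)) + (- 1) * J (k z) + (- w) * J k' = w ^+ 2 * J (r w).
    by move=> e; rewrite [in RHS]mulrA -e; ring.
  rewrite -(JZ _ bkz) -(JZ _ bk') -(JZ _ br) -(JD bk b1).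
  rewrite -(JD (bounded_contD bk b1) b2).
  by apply: eq_J => t Dt; rewrite -kE//; ring.
rewrite normrM normrX ler_wpM2l ?exprn_ge0// normrM tauE rmorphM.
rewrite ler_wpM2r//; first by rewrite lecR.
by apply: (le_trans (KP _ _ br (fun t => rM _ _ wd))); rewrite lecR ler_norm.
Qed.

(** Up to the factor [1 / (2 pi i)], the function of the second kind and its first two derivatives
    are [J (kern p 1 z)], [J (kern p 2 z)] and [2 * J (kern p 3 z)]. *)
Let kern (p : {poly R[i]}) k z t := p.[g t] * hz z t ^+ k.

Let bkern p k z : ~ trace g z -> bounded_cont D (kern p k z).
Proof.
move=> gz; apply: bounded_contM => //.
elim: k => [|k IH].
  by under [X in bounded_cont D X]funext do rewrite expr0; exact: bounded_cont_cst.
under [X in bounded_cont D X]funext do rewrite exprS.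
by apply: bounded_contM => //; exact: bhz.
Qed.

(** Half the distance from [z] to the loop serves both as radius of the disc and as distance from
    its points to the loop. *)
Let near_off_trace z : ~ trace g z -> exists2 d : R, 0 < d &
  forall w, `|w| <= d%:C -> ~ trace g (z + w) /\
    forall t, D t -> `|hz (z + w) t| <= d^-1%:C.
Proof.
move=> /(path_off_trace cg)[d d0 dz].
have d20 : 0 < d / 2 by rewrite divr_gt0.
exists (d / 2) => // w wd.
have dzw t : t \in `[0, 1] -> (d / 2)%:C <= `|g t - (z + w)|.
  move=> tI; rewrite opprD addrA; apply: le_trans (lerB_dist _ _).
  have -> : (d / 2)%:C = d%:C - (d / 2)%:C by rewrite -rmorphB; congr (_%:C); field.
  by rewrite lerB ?dz.
split; last by have [] := hz_bound d20 (fun t Dt => dzw t (DI Dt)).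
move=> [t /dzw + gtzw]; rewrite gtzw subrr normr0 lecR.
by rewrite leNgt d20.
Qed.

(* With [A = 1 / (zeta - z)] and [B = 1 / (zeta - z - w)], the second-order
   remainders are [B - A - w A^2 = w^2 A^2 B] and
   [B^2 - A^2 - 2 w A^3 = w^2 A^2 B (B + 2 A)]. *)
Let Jkern_quadratic1 p z : ~ trace g z ->
  exists2 d : R, 0 < d & exists2 C : R, 0 <= C & forall w, `|w| <= d%:C ->
    `|J (kern p 1 (z + w)) / two_pi_i R - J (kern p 1 z) / two_pi_i R
      - w * (J (kern p 2 z) / two_pi_i R)| <= `|w| ^+ 2 * C%:C.
Proof.
move=> gz; have [d d0 dP] := near_off_trace gz.
have z0 : `|0 : R[i]| <= d%:C by rewrite normr0 lecR ltW.
have [_ hM] := dP _ z0; rewrite addr0 in hM.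
have [_ [Mp pM]] := bpoly p.
exists d => //.
apply: (J_quadratic (r := fun w t => kern p 2 z t * hz (z + w) t)
  (* Bounds for [p], [A^2] and [B] in turn. *)
  (M := Mp * (d^-1 * d^-1) * d^-1) d0 (bkern _ _ gz)).
- move=> w wd; have [gzw _] := dP _ wd; split; first exact: bkern.
  by apply: bounded_contM; [exact: bkern|exact: bhz].
- move=> w t wd Dt; have [_ hwM] := dP _ wd.
  rewrite /kern expr2 !rmorphM !normrM.
  by rewrite !ler_pM ?mulr_ge0 ?pM ?hM ?hwM.
- move=> w t wd Dt; have [gzw _] := dP _ wd.
  have := chz gzw Dt; have := chz gz Dt; rewrite /kern /hz => ? ?.
  by field; apply/andP.
Qed.

(** The conclusion also keeps [z + w] off the loop, because the formula for the first derivative is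
    needed at these points to differentiate a second time. *)
Let Jkern_quadratic2 p z : ~ trace g z ->
  exists2 d : R, 0 < d & exists2 C : R, 0 <= C & forall w, `|w| <= d%:C ->
    ~ trace g (z + w) /\
    `|J (kern p 2 (z + w)) / two_pi_i R - J (kern p 2 z) / two_pi_i R
      - w * (2 * J (kern p 3 z) / two_pi_i R)| <= `|w| ^+ 2 * C%:C.
Proof.
move=> gz; have [d d0 dP] := near_off_trace gz.
have z0 : `|0 : R[i]| <= d%:C by rewrite normr0 lecR ltW.
have [_ hM] := dP _ z0; rewrite addr0 in hM.
have [_ [Mp pM]] := bpoly p.
exists d => //.
rewrite -JZ; last exact: bkern.
have [||||C C0 CP] := @J_quadratic (kern p 2)
  (fun w t => kern p 2 z t * hz (z + w) t * (hz (z + w) t + (hz z t + hz z t)))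
  (fun t => 2 * kern p 3 z t)
  d (Mp * (d^-1 * d^-1) * d^-1 * (d^-1 + (d^-1 + d^-1))) z d0.
- by apply: bounded_contM; [exact: bounded_cont_cst|exact: bkern].
- move=> w wd; have [gzw _] := dP _ wd; split; first exact: bkern.
  apply: bounded_contM.
    by apply: bounded_contM; [exact: bkern|exact: bhz].
  apply: bounded_contD; first exact: bhz.
  by apply: bounded_contD; exact: bhz.
- move=> w t wd Dt; have [_ hwM] := dP _ wd.
  rewrite /kern expr2 !(rmorphM, rmorphD) !normrM.
  apply: ler_pM; rewrite ?mulr_ge0//.
    by rewrite !ler_pM ?mulr_ge0 ?pM ?hM ?hwM.
  rewrite (le_trans (ler_normD _ _))// lerD ?hwM//.
  by rewrite (le_trans (ler_normD _ _))// lerD ?hM.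
- move=> w t wd Dt; have [gzw _] := dP _ wd.
  have := chz gzw Dt; have := chz gz Dt; rewrite /kern /hz => ? ?.
  by field; apply/andP.
by exists C => // w wd; split; [have [] := dP _ wd|exact: CP].
Qed.

Let second_kindE p z : second_kind g W p z = J (kern p 1 z) / two_pi_i R.
Proof.
congr (_ / _); apply: eq_cintegral => t _.
by rewrite /kern /hz /Phi expr1; ring.
Qed.

Let second_kind_fun p : R[i]^o -> R[i]^o := second_kind g W p.

Let is_derive_second_kind p z : ~ trace g z ->
  is_derive (z : R[i]^o) 1 (second_kind_fun p) (J (kern p 2 z) / two_pi_i R).
Proof.
move=> /(Jkern_quadratic1 p)[d d0 [C C0 CP]].
apply: (is_derive_quadratic d0 C0) => w wd.
by rewrite /second_kind_fun !second_kindE CP.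
Qed.

Let derive1_second_kind p z : ~ trace g z ->
  derive1 (second_kind_fun p) z = J (kern p 2 z) / two_pi_i R.
Proof.
by move=> gz; rewrite derive1E; apply: derive_val; exact: is_derive_second_kind.
Qed.

Let is_derive2_second_kind p z : ~ trace g z ->
  is_derive (z : R[i]^o) 1 (derive1 (second_kind_fun p))
    (2 * J (kern p 3 z) / two_pi_i R).
Proof.
move=> gz; have [d d0 [C C0 CP]] := Jkern_quadratic2 p gz.
apply: (is_derive_quadratic d0 C0) => w wd.
have [gzw le] := CP _ wd.
by rewrite !derive1_second_kind.
Qed.

Lemma second_kind_ode n p (z : R[i]^o) : monic_orthogonal g W n p -> ~ trace g z ->
  [/\ derivable (second_kind_fun p) z 1,
      derivable (derive1 (second_kind_fun p)) z 1 &
      z ^+ 2 * derive1 (derive1 (second_kind_fun p)) z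
      + ((4 - a)%:C * z - b) * derive1 (second_kind_fun p) z
      - (n%:R + 1) * (n%:R + a%:C - 2) * second_kind_fun p z = 0].
Proof.
move=> op gz.
have d1 := is_derive_second_kind p gz; have d2 := is_derive2_second_kind p gz.
split; [by case: d1|by case: d2|].
rewrite derive1_second_kind// derive1E (derive_val (is_derive := d2)).
rewrite /second_kind_fun second_kindE.
have Tp := bessel_op_orthogonal op.
have bk k : bounded_cont D (kern p k z) by exact: bkern.
have bcst c k : bounded_cont D (fun t => c * kern p k z t).
  by apply: bounded_contM => //; exact: bounded_cont_cst.
pose lam : R[i] := n%:R * (a%:C + n%:R - 1).
(* The opposite of the goal multiplied by [2 pi i], as [(n + 1) (n + a - 2) = lam + a - 2]. *)
have : (lam + a%:C - 2) * J (kern p 1 z) +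
  ((a%:C - 4) * z + b) * J (kern p 2 z) + (- 2 * z ^+ 2) * J (kern p 3 z) = 0.
  rewrite -!(JZ _ (bk _)) -(JD (bcst _ _) (bcst _ _)).
  rewrite -(JD (bounded_contD (bcst _ _) (bcst _ _)) (bcst _ _)).
  (* Here [q = p' h - p h'] with [h' = - h^2]; in its derivative the terms [p' h^2] cancel, leaving
     [p'' h - 2 p h^3]. *)
  rewrite -(J_ibp (q := fun t => kern p^`() 1 z t + kern p 2 z t)
    (q1 := fun t => kern p^`(2) 1 z t + (- 2) * kern p 3 z t)).
  - apply: eq_J => t Dt.
    have gtE : g t ^+ 2 * p^`(2).[g t] + (a%:C * g t + b) * p^`().[g t] =
        lam * p.[g t].
      by rewrite -[RHS]hornerZ -Tp /T /bessel_op !hornerE.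
    have h0 := chz gz Dt.
    (* Once the eigenvalue term is replaced by [T p], a rational identity in [zeta] and [z] remains,
       obtained by writing [zeta = z + 1 / h]. *)
    have E : lam * p.[g t] * hz z t = (g t ^+ 2 * p^`(2).[g t] +
      (a%:C * g t + b) * p^`().[g t]) * hz z t by rewrite -gtE.
    have -> : (lam + a%:C - 2) * kern p 1 z t = lam * p.[g t] * hz z t +
      (a%:C - 2) * kern p 1 z t by rewrite /kern expr1; ring.
    by rewrite E /kern /hz; field.
  - by apply: bounded_contD; exact: bkern.
  - apply: bounded_contD => //; exact: bkern.
  - move=> t Dt ts.
    have dh := dhz gz Dt ts.
    have d3 := cderivD (cderivM (dpoly p^`() Dt ts) dh)
      (cderivM (dpoly p Dt ts) (cderivM dh dh)).
    under [X in cderiv X]funext do rewrite /kern expr1 expr2.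
    by move: d3; congr cderiv; rewrite /kern -[p^`(2)]/(p^`()^`()); ring.
move=> E; apply/eqP; rewrite -oppr_eq0; apply/eqP.
rewrite -[RHS](mul0r (two_pi_i R)^-1) -E /lam rmorphB /=.
rewrite -[4%:C]/(4%:R%:C) rmorph_nat.
by ring.
Qed.

End BesselPolynomials.

Unset Implicit Arguments.
Set Strict Implicit.
Set Printing Implicit Defensive.


(** * The two second order equations, for polynomials and functions of the second kind *)

Theorem proposition4 (R : realType) (gamma : R -> R[i]) (lg : R[i] -> R[i])
    (a : R) (b : R[i]) (W := bessel_weight lg a b)
    (hgamma : loop_around_infinity gamma)
    (hlg : log_branch_along gamma lg)
    (ha : forall k : nat, a != - k.+1%:R)
    (hb : 0 < complex.Re b)
    (hW : regular_weight gamma W)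
    (P : nat -> {poly R[i]})
    (hP : forall n : nat, monic_orthogonal gamma W n (P n))
    (Q := (fun n : nat => second_kind gamma W (P n)) : nat -> R[i]^o -> R[i]^o) :
  forall n : nat,
    (forall z : R[i],
       z ^+ 2 * (P n)^`(2).[z] + (a%:C * z + b) * (P n)^`().[z]
       - n%:R * (a%:C + n%:R - 1) * (P n).[z] = 0) /\
    (forall z : R[i], ~ trace gamma z ->
       [/\ derivable (Q n) z 1,
           derivable (derive1 (Q n)) z 1 &
           z ^+ 2 * derive1 (derive1 (Q n)) z
           + ((4 - a)%:C * z - b) * derive1 (Q n) z
           - (n%:R + 1) * (n%:R + a%:C - 2) * Q n z = 0]).
Proof.
case: hgamma => -[cg [s [dg _ _]]] g0 g1 _ _ n.
have dgs t : `]0, 1[%classic t -> t \notin s ->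
    cderiv gamma t (path_deriv gamma t) /\ ccont (path_deriv gamma) t.
  move=> tI ts; have [d1 d2 c] := dg t tI ts.
  by split; [exact: path_derivP|exact: ccontP].
split=> z; last exact: (second_kind_ode cg dgs g0 g1 hlg hW).
(* The first equation is the polynomial identity [T p = n (a + n - 1) p] for [p = P n], evaluated at
   [z]. *)
have := bessel_op_orthogonal cg dgs g0 g1 hlg hW (hP n).
move=> /(congr1 (horner^~ z)); rewrite /bessel_op !hornerE => ->.
by rewrite subrr.
Qed.
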